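(* Let $m\ge1$ be an integer and $\tau>0$. Consider an $s$-stage Runge-Kutta method with real coefficients $a_{ij}$, $b_i$ ($i,j=1,\dots,s$) that is symplectic (quadratic preserving), i.e. $$b_ia_{ij}+b_ja_{ji}=b_ib_j\qquad\text{for all } i,j=1,\dots,s.$$ Apply it with time step $\tau$ to the spatially discretized generalized Benjamin-Ono equation $$\mathbf{u}_t=f(\mathbf u):=\mathbf{P}^{-1}\mathbf{F}^{-1}\mathbf{H}\mathbf{S}_2\mathbf{F}\mathbf{P}\,\mathbf{u}-\frac{1}{m+1}\Big(\mathrm{diag}(\mathbf{u}^{\mathbf{m-1}})\,\mathbf{P}^{-1}\mathbf{F}^{-1}\mathbf{S}_1\mathbf{F}\mathbf{P}\,\mathbf{u}+\mathbf{P}^{-1}\mathbf{F}^{-1}\mathbf{S}_1\mathbf{F}\mathbf{P}\,\mathbf{u}^{\mathbf m}\Big),$$ with the matrices defined in the context. Then the method conserves the discrete mass $M_h^n=\langle\mathbf u^n,\mathbf u^n\rangle_h$ exactly in time: $$M_h^{n+1}=M_h^n.$$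
   Context: The generalized Benjamin-Ono equation is $u_t=-(-\mathcal H u_x+\frac1m u^m)_x$ on $\mathbb R$, $u$ real-valued, $\mathcal H$ the Hilbert transform. Runge-Kutta method. For $\mathbf u_t=f(\mathbf u)$, one step from $\mathbf u^n$ to $\mathbf u^{n+1}$ consists of real intermediate values $\mathbf U_1,\dots,\mathbf U_s$ satisfying $\mathbf U_i=\mathbf u^n+\tau\sum_{j=1}^s a_{ij}f(\mathbf U_j)$, and $\mathbf u^{n+1}=\mathbf u^n+\tau\sum_{i=1}^s b_if(\mathbf U_i)$. The claim concerns any such step, for which the intermediate values exist. Discretization. Let $\alpha>0$, $N$ a positive even integer, $J=\{-N/2,\dots,N/2-1\}$; vectors and matrices are indexed by $J$. Put $\theta_j=2\pi j/N$, $x_j=\alpha\tan(\theta_j/2)$, so $x_{-N/2}=-\infty$. Define: - $\mathbf F_{kj}=\frac1N e^{-ik\theta_j}$ and $(\mathbf F^{-1})_{jk}=e^{ik\theta_j}$ (discrete Fourier matrix and its inverse); - $\mathbf P=\mathrm{diag}(\alpha-ix_j)_{j\in J}$ and $\mathbf W=\mathbf P\overline{\mathbf P}=\mathrm{diag}(w_j)$, $w_j=\alpha^2+x_j^2$; - $\mathbf S_1$ the tridiagonal matrix $(\mathbf S_1\hat{\mathbf u})_k=\frac{i}{2\alpha}\big[k\hat u_{k-1}+(2k+1)\hat u_k+(k+1)\hat u_{k+1}\big]$, where $\hat u_{k}:=0$ for $k\notin J$; $\mathbf S_2=\mathbf S_1\mathbf S_1$; - $\mathbf H=-i\,\mathrm{diag}(\mathrm{sgn}(k+\tfrac12))_{k\in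 J}$. Boundary convention at the node $x_{-N/2}=-\infty$: all grid vectors $\mathbf u=(u_j)_{j\in J}$ (including the intermediate values) are real with $u_{-N/2}=0$, and this node contributes nothing; i.e. the $-N/2$ diagonal entries of $\mathbf P$, $\mathbf P^{-1}$ and $\mathbf W$ are read as $0$ (the other diagonal entries of $\mathbf P^{-1}$ are $1/(\alpha-ix_j)$). The discrete inner product is $\langle\mathbf u,\mathbf v\rangle_h=\frac{\pi}{N\alpha}\overline{\mathbf v}^T\mathbf W\mathbf u=\frac{\pi}{N\alpha}\sum_{j\in J} w_ju_j\bar v_j$. Powers $\mathbf u^{\mathbf p}=(u_j^p)_j$ are entrywise, and $\mathrm{diag}(\mathbf v)$ is the diagonal matrix with diagonal $\mathbf v$. *)

(* Defs.v *)
From mathcomp Require Import all_boot all_order all_algebra.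
From mathcomp Require Import complex.
From mathcomp Require Import all_classical all_reals all_analysis.

Set Implicit Arguments.
Unset Strict Implicit.
Unset Printing Implicit Defensive.

Import Order.TTheory GRing.Theory Num.Theory.
Local Open Scope ring_scope.
Local Open Scope complex_scope.

(* Vectors and matrices indexed by J = {-N/2, ..., N/2-1} are represented over
   'I_N; freq i is the element of J at position i, so that position 0 stands
   for the index -N/2. N is meant to be positive and even. *)
Definition freq (N : nat) (i : 'I_N) : int := i%:Z - (N./2)%:Z.

Definition at_infinity (N : nat) (i : 'I_N) : bool := freq i == - (N./2)%:Z.

Definition cis (R : realType) (x : R) : R[i] := cos x +i* sin x.

Definition theta (R : realType) (N : nat) (j : 'I_N) : R :=
  2 * pi * (freq j)%:~R / N%:R.

(* At the infinite node the library's total tan returns 0; this value is never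
   used, since Pmx, Pinvmx and Wmx treat that node separately. *)
Definition node (R : realType) (N : nat) (alpha : R) (j : 'I_N) : R :=
  alpha * tan (theta R j / 2).

Definition Fmx (R : realType) (N : nat) : 'M[R[i]]_N :=
  \matrix_(k, j) (N%:R^-1 * cis (- ((freq k)%:~R * theta R j))).

Definition Finvmx (R : realType) (N : nat) : 'M[R[i]]_N :=
  \matrix_(j, k) cis ((freq k)%:~R * theta R j).

Definition Pmx (R : realType) (N : nat) (alpha : R) : 'M[R[i]]_N :=
  diag_mx (\row_j if at_infinity j then 0 else alpha -i* node alpha j).

Definition Pinvmx (R : realType) (N : nat) (alpha : R) : 'M[R[i]]_N :=
  diag_mx (\row_j if at_infinity j then 0 else (alpha -i* node alpha j)^-1).

Definition Wmx (R : realType) (N : nat) (alpha : R) : 'M[R[i]]_N :=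
  diag_mx (\row_j if at_infinity j then 0
                  else (alpha ^+ 2 + node alpha j ^+ 2)%:C).

(* Terms with an index outside J are dropped since columns range over J. *)
Definition S1mx (R : realType) (N : nat) (alpha : R) : 'M[R[i]]_N :=
  \matrix_(k, l) ((0 +i* 1) / (2 * alpha)%:C *
    (if freq l == freq k - 1 then freq k
     else if freq l == freq k then 2 * freq k + 1
     else if freq l == freq k + 1 then freq k + 1
     else 0)%:~R).

Definition S2mx (R : realType) (N : nat) (alpha : R) : 'M[R[i]]_N :=
  S1mx N alpha *m S1mx N alpha.

Definition Hmx (R : realType) (N : nat) : 'M[R[i]]_N :=
  - (0 +i* 1) *: diag_mx (\row_k (Num.sg ((freq k)%:~R + 2^-1 : R))%:C).

Definition vpow (K : pzSemiRingType) (N : nat) (u : 'cV[K]_N) (p : nat) :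
  'cV[K]_N := map_mx (fun z => z ^+ p) u.

Definition gBO_rhs (R : realType) (N m : nat) (alpha : R) (u : 'cV[R[i]]_N) :
  'cV[R[i]]_N :=
  let P := Pmx N alpha in
  let Pinv := Pinvmx N alpha in
  let F := Fmx R N in
  let Finv := Finvmx R N in
  let S1 := S1mx N alpha in
  let S2 := S2mx N alpha in
  let H := Hmx R N in
  Pinv *m Finv *m H *m S2 *m F *m P *m u
  - (m.+1%:R)^-1 *:
      (diag_mx (vpow u m.-1)^T *m Pinv *m Finv *m S1 *m F *m P *m u
       + Pinv *m Finv *m S1 *m F *m P *m vpow u m).

Definition grid_vector (R : realType) (N : nat) (u : 'cV[R[i]]_N) : Prop :=
  (forall j, u j 0 \is Num.real) /\ (forall j, at_infinity j -> u j 0 = 0).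

Definition inner_h (R : realType) (N : nat) (alpha : R) (u v : 'cV[R[i]]_N) :
  R[i] :=
  (pi / (N%:R * alpha))%:C * ((map_mx conjc v)^T *m Wmx N alpha *m u) 0 0.

Definition mass_h (R : realType) (N : nat) (alpha : R) (u : 'cV[R[i]]_N) :
  R[i] := inner_h alpha u u.

Definition symplectic_rk (R : realType) (s : nat) (a : 'I_s -> 'I_s -> R)
  (b : 'I_s -> R) : Prop :=
  forall i j, b i * a i j + b j * a j i = b i * b j.

Definition rk_step (R : realType) (N s : nat) (a : 'I_s -> 'I_s -> R)
  (b : 'I_s -> R) (tau : R) (f : 'cV[R[i]]_N -> 'cV[R[i]]_N)
  (u0 : 'cV[R[i]]_N) (U : 'I_s -> 'cV[R[i]]_N) (u1 : 'cV[R[i]]_N) : Prop :=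
  (forall i, U i = u0 + tau%:C *: \sum_(j < s) (a i j)%:C *: f (U j)) /\
  u1 = u0 + tau%:C *: \sum_(i < s) (b i)%:C *: f (U i).

(* Main.v *)
Require Import Defs.
From mathcomp Require Import all_boot all_order all_algebra.
From mathcomp Require Import complex.
From mathcomp Require Import all_classical all_reals all_analysis.
From mathcomp Require Import zify ring lra.

Set Implicit Arguments.
Unset Strict Implicit.
Unset Printing Implicit Defensive.

Import Order.TTheory GRing.Theory Num.Theory.
Local Open Scope ring_scope.
Local Open Scope complex_scope.

(** Two independent facts give the conservation of mass.

    A symplectic Runge-Kutta method preserves every quadratic invariant.
    Expanding the mass of u1 around u0 gives a term linear in tau, in which u0
    is replaced by U_i minus the stage increments.  What remains of order tau
    pairs f(U_i) with U_i, and vanishes because mass is invariant for the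
    differential equation; what remains of order tau^2 carries the coefficient
    b_i b_j - b_i a_ij - b_j a_ji, which is zero.  This is
    [symplectic_rk_conserves].

    The mass is invariant for the semi-discrete equation, that is, <f(u), u>_h
    has zero real part for real u.  Since W P^-1 is the adjoint of P and F^-1
    is N times the adjoint of F, the matrix W P^-1 F^-1 A F P is a positive
    multiple of (F P)^h A (F P), hence skew-Hermitian whenever A is
    ([discrete_operator_skew]).  This applies to A = S1, which is the imaginary
    unit times a real symmetric matrix, and to A = H S2, because S1 does not
    couple the frequencies k >= 0 with the frequencies k < 0 and so commutes
    with H.  Thus the dispersive term contributes nothing.  With D the operator
    P^-1 F^-1 S1 F P, moving the real factor u^(m-1) to the other side of the
    inner product turns the nonlinear term into <D u, u^m> + <D u^m, u>; by
    skewness this is z - conj z for z = <D u, u^m>, hence purely imaginary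
    ([rhs_mass_skew]). *)

(** * Symplectic Runge-Kutta methods and quadratic invariants *)

(** Cooper's theorem on quadratic invariants.  Linearity of B is only over the
    reals, so that the sesquilinear discrete inner product, which is conjugate
    linear in one argument, is an instance; the coefficients of the method are
    real.  The third premise says that the derivative of B u u along the flow
    of f vanishes at the stage values. *)
Lemma symplectic_rk_conserves (R : realType) (N s : nat)
  (a : 'I_s -> 'I_s -> R) (b : 'I_s -> R) (tau : R)
  (f : 'cV[R[i]]_N -> 'cV[R[i]]_N) (u0 u1 : 'cV[R[i]]_N)
  (U : 'I_s -> 'cV[R[i]]_N) (B : 'cV[R[i]]_N -> 'cV[R[i]]_N -> R[i]) :
  (forall (r : R) x y z, B (x + r%:C *: y) z = B x z + r%:C * B y z) ->
  (forall (r : R) x y z, B z (x + r%:C *: y) = B z x + r%:C * B z y) ->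
  (forall i, B (f (U i)) (U i) + B (U i) (f (U i)) = 0) ->
  symplectic_rk a b -> rk_step a b tau f u0 U u1 -> B u1 u1 = B u0 u0.
Proof.
move=> BDl BDr f_tangent symp [U_def ->].
have B0l z : B 0 z = 0.
  have := BDl 1 0 0 z; rewrite scaler0 addr0 mul1r => /eqP.
  by rewrite eq_sym -subr_eq0 addrK => /eqP.
have B0r z : B z 0 = 0.
  have := BDr 1 0 0 z; rewrite scaler0 addr0 mul1r => /eqP.
  by rewrite eq_sym -subr_eq0 addrK => /eqP.
have Bsuml (c : 'I_s -> R) (g : 'I_s -> 'cV[R[i]]_N) z :
    B (\sum_(i < s) (c i)%:C *: g i) z = \sum_(i < s) (c i)%:C * B (g i) z.
  apply: (big_rec2 (fun x y => B x z = y)) => // i x y _ <-.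
  by rewrite addrC BDl addrC.
have Bsumr (c : 'I_s -> R) (g : 'I_s -> 'cV[R[i]]_N) z :
    B z (\sum_(i < s) (c i)%:C *: g i) = \sum_(i < s) (c i)%:C * B z (g i).
  apply: (big_rec2 (fun x y => B z x = y)) => // i x y _ <-.
  by rewrite addrC BDr addrC.
pose G i j := B (f (U i)) (f (U j)).
(* The tangency at U i is transported to u0, at the cost of stage products. *)
have u0_tangent i : B (f (U i)) u0 + B u0 (f (U i)) =
    - tau%:C * \sum_(j < s) (a i j)%:C * (G i j + G j i).
  have := f_tangent i; rewrite {2 3}U_def BDl BDr Bsuml Bsumr.
  rewrite addrACA -mulrDr -big_split /= => /eqP; rewrite addr_eq0 => /eqP ->.
  by rewrite mulNr; congr (- (_ * _)); apply: eq_bigr => j _; rewrite mulrDr.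
rewrite BDl !BDr Bsumr Bsuml !Bsuml.
have -> : \sum_(i < s) (b i)%:C * B (f (U i)) (\sum_(j < s) (b j)%:C *: f (U j))
    = \sum_(i < s) \sum_(j < s) (b i)%:C * ((b j)%:C * G i j).
  by apply: eq_bigr => i _; rewrite Bsumr mulr_sumr.
set Q := \sum_(i < s) \sum_(j < s) _.
set X := \sum_(i < s) _; set Y := \sum_(i < s) _.
(* Exchanging i and j in half of the double sum makes the symplectic
   condition appear as the coefficient of G i j. *)
have XY : X + Y = - tau%:C * Q.
  rewrite -big_split /=.
  transitivity (- tau%:C * \sum_(i < s) \sum_(j < s)
      (b i)%:C * ((a i j)%:C * (G i j + G j i))).
    rewrite mulr_sumr; apply: eq_bigr => i _.
    by rewrite -mulrDr [B u0 _ + _]addrC u0_tangent mulrCA mulr_sumr.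
  congr (_ * _).
  transitivity (\sum_(i < s) \sum_(j < s) (b i)%:C * ((a i j)%:C * G i j) +
                \sum_(i < s) \sum_(j < s) (b j)%:C * ((a j i)%:C * G i j)).
    rewrite [X in _ = _ + X]exchange_big -big_split; apply: eq_bigr => i _ /=.
    by rewrite -big_split; apply: eq_bigr => j _ /=; rewrite !mulrDr.
  rewrite -big_split; apply: eq_bigr => i _ /=.
  rewrite -big_split; apply: eq_bigr => j _ /=.
  by rewrite !mulrA -mulrDl -!rmorphM -rmorphD symp.
rewrite -addrA -[RHS]addr0; congr (_ + _).
transitivity (tau%:C * (X + Y + tau%:C * Q)); last first.
  by rewrite XY mulNr addNr mulr0.
by ring.
Qed.

(** * Adjoints of complex matrices *)

Local Notation "A ^h" := (trmx (map_mx conjc A)) (at level 1, format "A ^h").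

Section Adjoint.
Variable R : realType.
Implicit Types n p q : nat.

Lemma adjmxM n p q (A : 'M[R[i]]_(n, p)) (B : 'M[R[i]]_(p, q)) :
  (A *m B)^h = B^h *m A^h.
Proof. by rewrite map_mxM trmx_mul. Qed.

Lemma adjmxK n p (A : 'M[R[i]]_(n, p)) : A^h^h = A.
Proof. by apply/matrixP=> i j; rewrite !mxE conjcK. Qed.

Lemma adjmxD n p (A B : 'M[R[i]]_(n, p)) : (A + B)^h = A^h + B^h.
Proof. by rewrite map_mxD linearD. Qed.

Lemma adjmxN n p (A : 'M[R[i]]_(n, p)) : (- A)^h = - A^h.
Proof. by rewrite map_mxN linearN. Qed.

Lemma adjmxZ n p c (A : 'M[R[i]]_(n, p)) : (c *: A)^h = conjc c *: A^h.
Proof. by rewrite map_mxZ linearZ. Qed.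

Lemma skew_adjmx_congr n p (A : 'M[R[i]]_n) (B : 'M[R[i]]_(n, p)) :
  A^h = - A -> (B^h *m A *m B)^h = - (B^h *m A *m B).
Proof. by move=> sA; rewrite !adjmxM adjmxK sA mulNmx mulmxN mulmxA. Qed.

Lemma adj_diag_mx n (d : 'rV[R[i]]_n) :
  (diag_mx d)^h = diag_mx (map_mx conjc d).
Proof. by rewrite map_diag_mx tr_diag_mx. Qed.
End Adjoint.

(** * The discretization matrices *)

Lemma conjcM (R : realType) : {morph @conjc R : x y / x * y}.
Proof. exact: rmorphM. Qed.

Lemma conjcN (R : realType) : {morph @conjc R : x / - x}.
Proof. exact: rmorphN. Qed.

Lemma conjc_int (R : realType) (k : int) : conjc k%:~R = k%:~R :> R[i].
Proof. exact: rmorph_int. Qed.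

Lemma conjc_imag (R : realType) : conjc (0 +i* 1) = - (0 +i* 1) :> R[i].
Proof. by apply/eqP; rewrite eq_complex /= oppr0 !eqxx. Qed.

Lemma S1mx_skew (R : realType) N (alpha : R) :
  (S1mx N alpha)^h = - S1mx N alpha.
Proof.
apply/matrixP=> k l; rewrite !mxE conjcM conjc_int -mulNr.
congr (_ * _).
  by rewrite conjcM conjc_imag conjc_inv conjc_real mulNr.
congr (_%:~R).
by do ![case: eqP => ?]; lia.
Qed.

(** The shift by one half puts the zero frequency on the nonnegative side. *)
Lemma sgr_half_int (R : realType) (k : int) :
  Num.sg (k%:~R + 2^-1 : R) = if 0 <= k then 1 else -1.
Proof.
case: leP => k0; first by rewrite gtr0_sg // ltr_wpDl ?ler0z // invr_gt0 ltr0n.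
have : (k%:~R : R) <= (-1)%:~R by rewrite ler_int; lia.
by move=> k1; rewrite ltr0_sg //; lra.
Qed.

Lemma Hmx_skew (R : realType) N : (Hmx R N)^h = - Hmx R N.
Proof.
rewrite adjmxZ conjcN conjc_imag opprK adj_diag_mx -scaleNr opprK.
by congr (_ *: diag_mx _); apply/rowP=> k; rewrite !mxE conjc_real.
Qed.

(** H is constant on the frequencies k >= 0 and on those k < 0.  The tridiagonal
    matrix S1 could couple these two blocks only through the entries at
    (0, -1) and (-1, 0), and both are zero. *)
Lemma Hmx_S1mx (R : realType) N (alpha : R) :
  Hmx R N *m S1mx N alpha = S1mx N alpha *m Hmx R N.
Proof.
rewrite -scalemxAl -scalemxAr; congr (_ *: _).
rewrite mul_diag_mx mul_mx_diag; apply/matrixP=> k l; rewrite !mxE.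
rewrite !sgr_half_int [RHS]mulrC.
have [-> | ->] : (0 <= freq k) = (0 <= freq l) \/
    (if freq l == freq k - 1 then freq k
     else if freq l == freq k then 2 * freq k + 1
     else if freq l == freq k + 1 then freq k + 1 else 0) = 0.
- by do ![case: eqP => ?]; lia.
- by [].
- by rewrite !mulr0.
Qed.

Lemma HS2_skew (R : realType) N (alpha : R) :
  (Hmx R N *m S2mx N alpha)^h = - (Hmx R N *m S2mx N alpha).
Proof.
rewrite /S2mx !adjmxM Hmx_skew S1mx_skew mulmxN mulNmx mulmxN opprK.
by rewrite [in RHS]mulmxA Hmx_S1mx -[in RHS]mulmxA Hmx_S1mx mulmxA.
Qed.

Lemma Finvmx_adj (R : realType) N :
  (0 < N)%N -> Finvmx R N = N%:R *: (Fmx R N)^h.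
Proof.
move=> N_gt0; apply/matrixP=> j k; rewrite !mxE conjcM conjc_inv conjc_nat.
rewrite mulrA mulfV ?mul1r ?pnatr_eq0 -?lt0n //.
by rewrite /cis /= cosN sinN opprK.
Qed.

Lemma Wmx_adj (R : realType) N (alpha : R) : (Wmx N alpha)^h = Wmx N alpha.
Proof.
rewrite adj_diag_mx; congr diag_mx; apply/rowP=> j; rewrite !mxE.
by case: ifP; rewrite ?rmorph0 ?conjc_real.
Qed.

(** At finite nodes this is |p|^2 / p = conj p for p = alpha - i x_j; at the
    infinite node both sides are 0 by convention. *)
Lemma Wmx_Pinvmx (R : realType) N (alpha : R) : 0 < alpha ->
  Wmx N alpha *m Pinvmx N alpha = (Pmx N alpha)^h.
Proof.
move=> alpha_gt0; rewrite adj_diag_mx mulmx_diag.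
congr diag_mx; apply/rowP=> j; rewrite !mxE.
case: ifP => _; first by rewrite mulr0 rmorph0.
set x := node _ _; set p := alpha -i* x.
have p_neq0 : p != 0 by rewrite eq_complex /= negb_and gt_eqF.
apply: (canLR (mulfK p_neq0)).
rewrite /p /=; apply/eqP; rewrite eq_complex /=.
by apply/andP; split; apply/eqP; ring.
Qed.

(** The conjugation of A in the definition of the scheme is, after weighting by
    W, a congruence, and congruences preserve skew-Hermitian matrices. *)
Lemma discrete_operator_skew (R : realType) N (alpha : R) (A : 'M[R[i]]_N) :
  (0 < N)%N -> 0 < alpha -> A^h = - A ->
  let K := Wmx N alpha *m
    (Pinvmx N alpha *m Finvmx R N *m A *m Fmx R N *m Pmx N alpha) in
  K^h = - K.
Proof.
move=> N_gt0 alpha_gt0 A_skew K.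
have -> : K = N%:R *:
    ((Fmx R N *m Pmx N alpha)^h *m A *m (Fmx R N *m Pmx N alpha)).
  rewrite /K !mulmxA Wmx_Pinvmx // Finvmx_adj // -scalemxAr -!scalemxAl.
  by rewrite adjmxM ?mulmxA.
by rewrite adjmxZ conjc_nat skew_adjmx_congr // scalerN.
Qed.

(** * Mass conservation *)

(** The 1 x 1 matrix q is <f(u), u>_h up to a positive factor; its being
    skew-Hermitian says that this inner product has zero real part. *)
Lemma rhs_mass_skew (R : realType) (N m : nat) (alpha : R) (u : 'cV[R[i]]_N) :
  (0 < N)%N -> 0 < alpha -> (1 <= m)%N ->
  (forall j, u j 0 \is Num.real) ->
  let q := u^h *m Wmx N alpha *m gBO_rhs m alpha u in q^h = - q.
Proof.
move=> N_gt0 alpha_gt0 m_ge1 u_real q.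
pose W := Wmx N alpha; pose P := Pmx N alpha; pose Q := Pinvmx N alpha.
pose F := Fmx R N; pose G := Finvmx R N.
pose L := W *m (Q *m G *m (Hmx R N *m S2mx N alpha) *m F *m P).
pose D := W *m (Q *m G *m S1mx N alpha *m F *m P).
have L_skew : L^h = - L by apply: discrete_operator_skew => //; apply: HS2_skew.
have D_skew : D^h = - D by apply: discrete_operator_skew => //; apply: S1mx_skew.
pose v := vpow u m.
(* The real diagonal factor u^(m-1) moves to the left argument, where it merges
   with u; the merging requires m >= 1, as m.-1 is truncated at 0. *)
have u_diag : u^h *m W *m diag_mx (vpow u m.-1)^T = v^h *m W.
  rewrite -mulmxA /W /Wmx diag_mxC mulmxA; congr (_ *m _).
  rewrite mul_mx_diag; apply/matrixP=> i j; rewrite !mxE (ord1 i).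
  have /complex_realP [r ->] := u_real j.
  by rewrite -(rmorphXn (real_complex R) m) !conjc_real -exprS prednK ?rmorphXn.
pose c : R[i] := (m.+1%:R)^-1.
have -> : q = u^h *m L *m u - c *: (v^h *m D *m u + u^h *m D *m v).
  rewrite /q /gBO_rhs mulmxBr -(scalemxAr c) mulmxDr; congr (_ - _ *: (_ + _)).
  - by rewrite /L !mulmxA.
  - by rewrite !mulmxA u_diag.
  - by rewrite /D !mulmxA.
clear u_diag; clearbody L D v.
have vDu : (v^h *m D *m u)^h = - (u^h *m D *m v).
  by rewrite !adjmxM adjmxK D_skew mulNmx mulmxN mulmxA.
rewrite adjmxD skew_adjmx_congr // adjmxN adjmxZ adjmxD vDu.
have -> : (u^h *m D *m v)^h = - (v^h *m D *m u).
  by rewrite -[X in X^h]opprK -vDu adjmxN adjmxK.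
have -> : conjc c = c by rewrite conjc_inv conjc_nat.
have -> : - (u^h *m D *m v) - v^h *m D *m u = - (v^h *m D *m u + u^h *m D *m v).
  by rewrite opprD addrC.
by rewrite scalerN [RHS]opprD.
Qed.

Theorem theorem3p3 (R : realType) (N m s : nat) (alpha tau : R)
  (a : 'I_s -> 'I_s -> R) (b : 'I_s -> R)
  (u0 u1 : 'cV[R[i]]_N) (U : 'I_s -> 'cV[R[i]]_N)
  (N_gt0 : (0 < N)%N) (N_even : ~~ odd N) (m_ge1 : (1 <= m)%N)
  (alpha_gt0 : 0 < alpha) (tau_gt0 : 0 < tau)
  (symp : symplectic_rk a b)
  (u0_grid : grid_vector u0) (U_grid : forall i, grid_vector (U i))
  (step : rk_step a b tau (gBO_rhs m alpha) u0 U u1) :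
  mass_h alpha u1 = mass_h alpha u0.
Proof.
apply: symplectic_rk_conserves symp step => [r x y z|r x y z|i].
- by rewrite /inner_h mulmxDr -scalemxAr !mxE; ring.
- rewrite /inner_h adjmxD adjmxZ conjc_real !mulmxDl -!scalemxAl !mxE; ring.
- have skew := rhs_mass_skew N_gt0 alpha_gt0 m_ge1 (U_grid i).1.
  rewrite /inner_h -mulrDr.
  (* W is Hermitian, so <u, f(u)>_h is the conjugate of <f(u), u>_h. *)
  have -> : (gBO_rhs m alpha (U i))^h *m Wmx N alpha *m U i =
     - ((U i)^h *m Wmx N alpha *m gBO_rhs m alpha (U i)).
    by rewrite -skew !adjmxM adjmxK Wmx_adj mulmxA.
  by rewrite [X in _ + X]mxE subrr mulr0.
Qed.
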